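(* Let $R$ be a commutative ring, $A,B$ finite $R$-modules with $A\ne 0$, $C$ a cyclic group of odd order $r$, and $\lambda:A\times B\to C$ a $\mathbb{Z}$-bilinear, $R$-balanced, non-degenerate pairing; let $\mathcal{H}=\mathcal{H}(A,B,C,\lambda)$. Consider the diagram whose top row is the exact sequence $1\to\mathrm{Inn}(\mathcal{H})\to\mathrm{Aut}^0_R(\mathcal{H})\to\mathrm{Out}^0_R(\mathcal{H})\to 1$, whose bottom row is $1\to\mathrm{Hom}(A\oplus B,C)\to\mathrm{Hom}(A\oplus B,C)\rtimes\mathrm{Sp}_R(A\oplus B;\delta)\to\mathrm{Sp}_R(A\oplus B;\delta)\to1$ (with the obvious inclusion $\eta\mapsto(\eta,\mathrm{id})$ and projection), and whose vertical maps are $\Theta_1:\mathrm{Inn}(\mathcal{H})\to\mathrm{Hom}(A\oplus B,C)$, $\phi_h\mapsto\eta_{\phi_h}$; $\Theta_{\mathcal{D}}:\phi\mapsto(\eta_\phi,\bar\phi^{-1})$; and $\tilde\Theta:\mathrm{Out}^0_R(\mathcal{H})\to\mathrm{Sp}_R(A\oplus B;\delta)$, $\hat\phi\mapsto\bar\phi^{-1}$. Then this diagram commutes and has exact rows, and all three vertical maps are well-defined anti-isomorphisms. Moreover the map $\bar\Theta:\mathrm{Out}^0_R(\mathcal{H})\to\mathrm{Sp}_R(A\oplus B;\delta)$, $\hat\phi\mapsto\bar\phi$, is a group isomorphism.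
   Context: $\mathcal{H}(A,B,C,\lambda)$ is the set $A\times B\times C$, elements $h(a,b,c)$, multiplication $h(a,b,c)h(a',b',c')=h(a+a',b+b',c+c'+\lambda(a,b'))$. $R$-balanced: $\lambda(ra,b)=\lambda(a,rb)$; non-degenerate: trivial left and right kernels. $m:C\to\mathcal{H}$, $c\mapsto h(0,0,c)$; here $m(C)=Z(\mathcal{H})$ and $\mathcal{H}/Z(\mathcal{H})$ is identified with $A\oplus B$. For $\phi\in\mathrm{Aut}(\mathcal{H})$, $\bar\phi$ denotes the induced automorphism of $A\oplus B$ and $\hat\phi$ its class in outer automorphisms. $\mathrm{Aut}^0_R(\mathcal{H})$: automorphisms fixing $Z(\mathcal{H})$ elementwise with $\bar\phi$ $R$-linear; it contains $\mathrm{Inn}(\mathcal{H})$, and $\mathrm{Out}^0_R(\mathcal{H})=\mathrm{Aut}^0_R(\mathcal{H})/\mathrm{Inn}(\mathcal{H})$. $\phi_h$ is conjugation $g\mapsto hgh^{-1}$. $\delta((a,b),(a',b'))=\lambda(a,b')-\lambda(a',b)$; $\mathrm{Sp}_R(A\oplus B;\delta)$ is the group of $R$-linear automorphisms of $A\oplus B$ preserving $\delta$. $\mathcal{D}((a,b))=h(a,b,\tfrac12\lambda(a,b))$ (halving in the odd-order group $C$), and $\eta_\phi:A\oplus B\to C$ is defined by $\phi(\mathcal{D}(\mathbf{a}))=\mathcal{D}(\bar\phi(\mathbf{a}))m(\eta_\phi(\mathbf{a}))$. The semidirect product has multiplication $(\eta_1,\alpha_1)(\eta_2,\alpha_2)=(\eta_1+\eta_2\circ\alpha_1^{-1},\alpha_1\alpha_2)$.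 An anti-isomorphism is a bijection reversing the order of products. *)

(* Defs.v *)
From HB Require Import structures.
From mathcomp Require Import all_boot all_algebra all_fingroup all_solvable.
(* For asbool: R may be infinite, so R-linearity is decided classically. *)
From mathcomp Require Import boolp.

Set Implicit Arguments.
Unset Strict Implicit.
Unset Printing Implicit Defensive.

Import GRing.Theory.
Local Open Scope ring_scope.

(* The product of the library's {perm T} applies the left factor first. The
   permutation group cperm T below has the usual product of automorphisms,
   (s * t) x = s (t x), so that the distinction between isomorphisms and
   anti-isomorphisms is the usual one. *)
Record cperm (T : finType) := CPerm { cperm_val : {perm T} }.

Definition cperm_fun (T : finType) (s : cperm T) : T -> T := cperm_val s.
Coercion cperm_fun : cperm >-> Funclass.
Arguments cperm_fun : simpl never.

Section CPerm.
Local Open Scope group_scope.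
Variable T : finType.
Implicit Types s t : cperm T.

Fact cperm_valK : cancel (@cperm_val T) (@CPerm T). Proof. by case. Qed.
HB.instance Definition _ := Finite.copy (cperm T) (can_type cperm_valK).

Definition cperm_mul s t : cperm T := CPerm (cperm_val t * cperm_val s).
Definition cperm_one : cperm T := CPerm 1.
Definition cperm_inv s : cperm T := CPerm (cperm_val s)^-1.

Fact cperm_mulA : associative cperm_mul.
Proof. by move=> s t u; rewrite /cperm_mul /= mulgA. Qed.
Fact cperm_mul1 : left_id cperm_one cperm_mul.
Proof. by case=> s; rewrite /cperm_mul /= mulg1. Qed.
Fact cperm_mulV : left_inverse cperm_one cperm_inv cperm_mul.
Proof. by case=> s; rewrite /cperm_mul /= mulgV. Qed.

HB.instance Definition _ :=
  Finite_isGroup.Build (cperm T) cperm_mulA cperm_mul1 cperm_mulV.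

Lemma cpermP s t : s =1 t <-> s = t.
Proof.
by split=> [|-> //]; case: s t => s [t] eq_st; congr CPerm; apply/permP.
Qed.

Lemma cpermE (f : T -> T) (f_inj : injective f) : CPerm (perm f_inj) =1 f.
Proof. exact: permE. Qed.

Lemma cpermM s t x : (s * t) x = s (t x).
Proof. exact: permM. Qed.

Lemma cperm1 x : (1 : cperm T) x = x.
Proof. exact: perm1. Qed.

Lemma cpermK s : cancel s s^-1.
Proof. by move=> x; rewrite -cpermM mulVg cperm1. Qed.

Lemma cpermKV s : cancel s^-1 s.
Proof. by move=> x; rewrite -cpermM mulgV cperm1. Qed.

End CPerm.

(* Makes {ffun T -> C} a group for pointwise addition. *)
HB.instance Definition _ (T : finType) (C : finZmodType) :=
  [finGroupMixin of {ffun T -> C} for +%R].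

(* The semidirect product of {ffun T -> C} with the permutations of T, with
   alpha acting by eta |-> eta \o alpha^-1; Hom(A (+) B, C) >| Sp is a
   subgroup of it for T = A * B. *)
Record fsdprod (T : finType) (C : finZmodType) :=
  Fsd { fsd1 : {ffun T -> C}; fsd2 : cperm T }.

Section FsdGroup.
Variables (T : finType) (C : finZmodType).
Local Notation fsd := (fsdprod T C).
Implicit Types x y : fsd.

Definition fsd_to_prod x := (fsd1 x, fsd2 x).
Definition fsd_of_prod (p : {ffun T -> C} * cperm T) : fsd := Fsd p.1 p.2.
Fact fsd_prodK : cancel fsd_to_prod fsd_of_prod. Proof. by case. Qed.
HB.instance Definition _ := Finite.copy fsd (can_type fsd_prodK).

Definition fsd_mul x y : fsd :=
  Fsd [ffun t => fsd1 x t + fsd1 y ((fsd2 x)^-1%g t)] (fsd2 x * fsd2 y)%g.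
Definition fsd_one : fsd := Fsd 0 1%g.
Definition fsd_inv x : fsd := Fsd [ffun t => - fsd1 x (fsd2 x t)] (fsd2 x)^-1%g.

Fact fsd_mulA : associative fsd_mul.
Proof.
case=> [e s] [f t] [g u]; rewrite /fsd_mul /= mulgA; congr Fsd.
by apply/ffunP=> z; rewrite !ffunE invMg cpermM addrA.
Qed.
Fact fsd_mul1 : left_id fsd_one fsd_mul.
Proof.
case=> [e s]; rewrite /fsd_mul /= mul1g; congr Fsd.
by apply/ffunP=> z; rewrite !ffunE invg1 cperm1 add0r.
Qed.
Fact fsd_mulV : left_inverse fsd_one fsd_inv fsd_mul.
Proof.
case=> [e s]; rewrite /fsd_mul /= mulVg; congr Fsd.
by apply/ffunP=> z; rewrite !ffunE invgK addNr.
Qed.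

HB.instance Definition _ :=
  Finite_isGroup.Build fsd fsd_mulA fsd_mul1 fsd_mulV.
End FsdGroup.

Section ExactAndAnti.
Local Open Scope group_scope.

Definition hom_on (gT rT : finGroupType) (G : {set gT}) (K : {set rT})
    (f : gT -> rT) : Prop :=
  {in G, forall x, f x \in K} /\ {in G &, {morph f : x y / x * y}}.

Definition short_exact (gT rT sT : finGroupType)
    (G : {group gT}) (K : {group rT}) (Q : {group sT})
    (i : gT -> rT) (p : rT -> sT) : Prop :=
  [/\ hom_on G K i, hom_on K Q p,
      {in G &, injective i},
      i @: G = [set x in K | p x == 1] &
      p @: K = Q].

Definition anti_isom (gT rT : finGroupType) (G : {group gT}) (K : {group rT})
    (f : gT -> rT) : Prop :=
  [/\ {in G &, forall x y, f (x * y) = f y * f x},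
      {in G &, injective f} & f @: G = K].
End ExactAndAnti.

Section Pairing.
Variables (R : comNzRingType) (A B : finLmodType R) (C : finZmodType).

Record pairing := Pairing {
  pair_fun :> A -> B -> C;
  pairDl : forall a a' b, pair_fun (a + a') b = pair_fun a b + pair_fun a' b;
  pairDr : forall a b b', pair_fun a (b + b') = pair_fun a b + pair_fun a b' }.

Definition R_balanced (lam : pairing) : Prop :=
  forall (r : R) a b, lam (r *: a) b = lam a (r *: b).

Definition nondegenerate_pairing (lam : pairing) : Prop :=
  (forall a, (forall b, lam a b = 0) -> a = 0) /\
  (forall b, (forall a, lam a b = 0) -> b = 0).

Lemma pair0l (lam : pairing) b : lam 0 b = 0.
Proof. by apply: (addrI (lam 0 b)); rewrite -pairDl !addr0. Qed.
Lemma pair0r (lam : pairing) a : lam a 0 = 0.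
Proof. by apply: (addrI (lam a 0)); rewrite -pairDr !addr0. Qed.
Lemma pairNl (lam : pairing) a b : lam (- a) b = - lam a b.
Proof. by apply: (addrI (lam a b)); rewrite -pairDl !subrr pair0l. Qed.

End Pairing.

Section Heisenberg.
Variables (R : comNzRingType) (A B : finLmodType R) (C : finZmodType).
Variable lam : pairing A B C.

(* The parameter l is not used by the carrier: it selects the group law. *)
Record heis (l : pairing A B C) := Heis { hA : A; hB : B; hC : C }.

Definition heis_to_prod (g : heis lam) : A * B * C := (hA g, hB g, hC g).
Definition heis_of_prod (x : A * B * C) : heis lam := Heis lam x.1.1 x.1.2 x.2.
Fact heis_prodK : cancel heis_to_prod heis_of_prod. Proof. by case. Qed.
HB.instance Definition _ := Finite.copy (heis lam) (can_type heis_prodK).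

Definition heis_mul (g h : heis lam) : heis lam :=
  Heis lam (hA g + hA h) (hB g + hB h) (hC g + hC h + lam (hA g) (hB h)).
Definition heis_one : heis lam := Heis lam 0 0 0.
Definition heis_inv (g : heis lam) : heis lam :=
  Heis lam (- hA g) (- hB g) (- hC g + lam (hA g) (hB g)).

Fact heis_mulA : associative heis_mul.
Proof.
case=> a b c [a' b' c'] [a'' b'' c'']; rewrite /heis_mul /=.
rewrite pairDl pairDr !addrA; congr (Heis lam _ _ _).
by rewrite -!addrA; do 2!congr (_ + _); rewrite [RHS]addrCA; congr (_ + _);
   rewrite addrC -addrA.
Qed.
Fact heis_mul1 : left_id heis_one heis_mul.
Proof. by case=> a b c; rewrite /heis_mul /= pair0l !add0r addr0. Qed.
Fact heis_mulV : left_inverse heis_one heis_inv heis_mul.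
Proof.
case=> a b c; rewrite /heis_mul /= pairNl !addNr.
by congr (Heis lam _ _ _); rewrite addrAC addrK addNr.
Qed.

HB.instance Definition _ :=
  Finite_isGroup.Build (heis lam) heis_mulA heis_mul1 heis_mulV.

Definition m (c : C) : heis lam := Heis lam 0 0 c.

(* The identification of H / m(C) with A (+) B, precomposed with the
   quotient map. *)
Definition pr (g : heis lam) : A * B := (hA g, hB g).

Definition AutH : {set cperm (heis lam)} :=
  [set phi : cperm (heis lam) | cperm_val phi \in Aut [set: heis lam]].

(* The permutation beta of A (+) B such that beta \o pr = pr \o phi; it exists
   for every automorphism fixing the centre (barP), and the default value 1 is
   irrelevant otherwise. *)
Definition bar (phi : cperm (heis lam)) : cperm (A * B)%type :=
  odflt 1%g [pick beta : cperm (A * B)%type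
            | [forall g, pr (phi g) == beta (pr g)]].

Definition Aut0_set : {set cperm (heis lam)} :=
  [set phi in AutH | [forall z in 'Z([set: heis lam])%g, phi z == z]
                     && `[< linear (bar phi : A * B -> A * B) >]].

Fact conj_inj (h : heis lam) : injective (fun g => h * g * h^-1)%g.
Proof. by move=> x y /mulIg /mulgI. Qed.
Definition conj_by (h : heis lam) : cperm (heis lam) :=
  CPerm (perm (@conj_inj h)).

Definition Inn_set : {set cperm (heis lam)} :=
  [set conj_by h | h in [set: heis lam]].

Definition delta (x y : A * B) : C := lam x.1 y.2 - lam y.1 x.2.

Definition Sp_set : {set cperm (A * B)%type} :=
  [set alpha : cperm (A * B)%type | `[< linear (alpha : A * B -> A * B) >]
    && [forall x, forall y, delta (alpha x) (alpha y) == delta x y]].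

(* C carries no R-action: these are the homomorphisms of abelian groups. *)
Definition Hom_set : {set {ffun A * B -> C}} :=
  [set eta : {ffun A * B -> C}
  | [forall x : A * B, forall y : A * B, eta (x + y) == eta x + eta y]].

(* For #|C| odd, (#|C| + 1) / 2 inverts 2 modulo the order of C. *)
Definition half (c : C) : C := c *+ uphalf #|C|.

Definition D (x : A * B) : heis lam := Heis lam x.1 x.2 (half (lam x.1 x.2)).

(* The map e such that phi (D x) = D (bar phi x) * m (e x) for all x, and 0 if
   there is none. *)
Definition eta (phi : cperm (heis lam)) : {ffun A * B -> C} :=
  odflt 0 [pick e : {ffun A * B -> C}
          | [forall x, phi (D x) == (D (bar phi x) * m (e x))%g]].

Lemma halfK (c : C) : odd #|C| -> half c *+ 2 = c.
Proof.
move=> oC; rewrite /half -mulrnA muln2 uphalfE.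
have -> : ((#|C|.+1)./2.*2 = #|C|.+1)%N.
  by rewrite -[RHS]odd_double_half /= oC.
rewrite mulrS -[X in _ + X]/((c : C) ^+ #|C|)%g -cardsT.
by rewrite (@expg_cardG _ [group of [set: C]]) ?inE // addr0.
Qed.

Lemma mA (g : heis lam) c : (g * m c)%g = Heis lam (hA g) (hB g) (hC g + c).
Proof.
by case: g => a b d; congr (Heis lam _ _ _); rewrite /= ?pair0r ?addr0.
Qed.

Lemma prM (g h : heis lam) : pr (g * h)%g = pr g + pr h.
Proof. by []. Qed.

Lemma pr_fibre (g h : heis lam) : pr g = pr h -> h = (g * m (hC h - hC g))%g.
Proof.
by rewrite mA; case: g h => a b c [a' b' c'] [-> ->] /=; rewrite addrC subrK.
Qed.

Lemma m_center c : m c \in ('Z([set: heis lam]))%g.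
Proof.
apply/centerP; split=> [|g _]; first by rewrite inE.
rewrite /commute mA; case: g => a b d; congr (Heis lam _ _ _);
  by rewrite /= ?add0r ?pair0l ?addr0 // addrC.
Qed.

Lemma center_heis :
  nondegenerate_pairing lam -> ('Z([set: heis lam]) = m @: [set: C])%g.
Proof.
move=> [ndl ndr]; apply/setP=> z; apply/idP/imsetP => [|[c _ ->]]; last first.
  exact: m_center.
case: z => a b c /centerP[_ zC]; exists c; rewrite ?inE // /m.
have zE a' b' : lam a b' = lam a' b.
  have /(congr1 (@hC lam)) := zC (Heis lam a' b' 0) (in_setT _).
  by rewrite /= addr0 add0r => /addrI.
congr (Heis lam _ _ _); first by apply: ndl => b'; rewrite (zE 0) pair0l.
by apply: ndr => a'; rewrite -(zE a' 0) pair0r.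
Qed.

Lemma AutHP (phi : cperm (heis lam)) :
  reflect {morph phi : x y / (x * y)%g} (phi \in AutH).
Proof.
rewrite inE /Aut inE; apply: (iffP andP) => [[_ /morphicP M] x y|M].
  by apply: M; rewrite inE.
split; first by apply/subsetP=> x; rewrite inE.
by apply/morphicP=> x y _ _; apply: M.
Qed.

Lemma bar_unique (phi : cperm (heis lam)) (beta : cperm (A * B)%type) :
  (forall g, pr (phi g) = beta (pr g)) -> bar phi = beta.
Proof.
move=> Hb; rewrite /bar; case: pickP => [gamma /forallP Hg | /(_ beta)] /=.
  by apply/cpermP=> -[a b]; rewrite -[(a, b)]/(pr (Heis lam a b 0)) -(eqP (Hg _)) Hb.
by move/negP; case; apply/forallP=> g; rewrite Hb.
Qed.

Lemma barP (phi : cperm (heis lam)) : phi \in AutH ->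
  {in 'Z([set: heis lam])%g, forall z, phi z = z} ->
  forall g, pr (phi g) = bar phi (pr g).
Proof.
move=> /AutHP M Z.
pose f x := pr (phi (Heis lam x.1 x.2 0)).
have fP g : pr (phi g) = f (pr g).
  rewrite (@pr_fibre (Heis lam (hA g) (hB g) 0) g) //.
  by rewrite M (Z _ (m_center _)) !mA.
have f_inj : injective f.
  move=> x y /pr_fibre; rewrite -{1}(Z _ (m_center _)) -M => /(can_inj (cpermK phi)).
  by rewrite mA; case: x y => [a b] [a' b'] [-> ->].
have Hb g : pr (phi g) = CPerm (perm f_inj) (pr g) by rewrite fP cpermE.
by move=> g; rewrite (bar_unique Hb).
Qed.

Lemma Aut0P (phi : cperm (heis lam)) :
  phi \in Aut0_set <->
  [/\ phi \in AutH, {in 'Z([set: heis lam])%g, forall z, phi z = z}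
    & linear (bar phi : A * B -> A * B)].
Proof.
rewrite inE; split=> [/and3P[-> /forall_inP Z /asboolP L]|[-> Z /asboolP ->]].
  by split=> // z /Z /eqP.
by rewrite andbT; apply/forall_inP=> z /Z ->.
Qed.

Fact Aut0_group_set : group_set Aut0_set.
Proof.
apply/group_setP; split.
  have M1 : (1 : cperm (heis lam))%g \in AutH.
    by apply/AutHP=> x y; rewrite !cperm1.
  have b1 : bar (1 : cperm (heis lam))%g = 1%g.
    by apply: bar_unique => g; rewrite !cperm1.
  by apply/Aut0P; split=> [//|z _|]; rewrite ?b1 ?cperm1 //;
     move=> r x y; rewrite !cperm1.
move=> phi psi /Aut0P[Mf Zf Lf] /Aut0P[Mg Zg Lg].
have bM : bar (phi * psi)%g = (bar phi * bar psi)%g.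
  by apply: bar_unique => g; rewrite !cpermM !barP.
apply/Aut0P; split.
- by apply/AutHP=> x y; rewrite !cpermM (AutHP _ Mg) (AutHP _ Mf).
- by move=> z zZ; rewrite cpermM Zg ?Zf.
- by rewrite bM => r x y; rewrite !cpermM Lg Lf.
Qed.
Canonical Aut0 := Group Aut0_group_set.

Lemma conj_byE (h g : heis lam) : conj_by h g = (h * g * h^-1)%g.
Proof. exact: cpermE. Qed.

Fact Inn_group_set : group_set Inn_set.
Proof.
apply/group_setP; split.
  apply/imsetP; exists 1%g; rewrite ?inE //; apply/cpermP=> g.
  by rewrite conj_byE cperm1 invg1 mulg1 mul1g.
move=> _ _ /imsetP[h _ ->] /imsetP[k _ ->]; apply/imsetP; exists (h * k)%g.
  by rewrite inE.
by apply/cpermP=> g; rewrite cpermM !conj_byE invMg !mulgA.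
Qed.
Canonical Inn := Group Inn_group_set.

Lemma conj_by_bar (h : heis lam) : bar (conj_by h) = 1%g.
Proof.
apply: bar_unique => g; rewrite cperm1 conj_byE !prM addrAC.
by rewrite -prM mulgV add0r.
Qed.

(* Hence Aut0 / Inn is the usual quotient group. *)
Lemma Inn_normal : (Inn <| Aut0)%g.
Proof.
apply/andP; split.
  apply/subsetP=> _ /imsetP[h _ ->]; apply/Aut0P; split.
  - by apply/AutHP=> x y; rewrite !conj_byE -!mulgA mulKg.
  - by move=> z /centerP[_ zC]; rewrite conj_byE -[(h * z)%g]zC ?inE // mulgK.
  - by rewrite conj_by_bar; move=> r x y; rewrite !cperm1.
apply/normsP=> phi /Aut0P[/AutHP M _ _].
apply/eqP; rewrite eqEcard cardJg leqnn andbT.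
apply/subsetP=> _ /imsetP[_ /imsetP[h _ ->] ->].
apply/imsetP; exists ((phi^-1)%g h); rewrite ?inE //; apply/cpermP=> g.
have M1 : phi 1%g = 1%g by apply: (mulgI (phi 1%g)); rewrite -M !mulg1.
have MV x : phi (x^-1)%g = ((phi x)^-1)%g.
  by apply: (mulgI (phi x)); rewrite -M !mulgV M1.
apply: (can_inj (cpermK phi)).
by rewrite /conjg !cpermM cpermKV !conj_byE !M MV cpermKV.
Qed.

Definition Out0 := (Aut0 / Inn)%G.

Fact Sp_group_set : group_set Sp_set.
Proof.
apply/group_setP; split.
  rewrite inE; apply/andP; split.
    by apply/asboolP; move=> r x y; rewrite !cperm1.
  by apply/forallP=> x; apply/forallP=> y; rewrite !cperm1.
move=> s t; rewrite !inE => /andP[/asboolP Ls /forallP Hs].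
move=> /andP[/asboolP Lt /forallP Ht]; apply/andP; split.
  by apply/asboolP=> r x y; rewrite !cpermM Lt Ls.
apply/forallP=> x; apply/forallP=> y; rewrite !cpermM.
by rewrite (eqP (forallP (Hs _) _)); apply: (forallP (Ht _)).
Qed.
Canonical Sp := Group Sp_group_set.

Fact Hom_group_set : group_set Hom_set.
Proof.
apply/group_setP; split.
  rewrite inE; apply/forallP=> x; apply/forallP=> y.
  by rewrite [1%g]/(0 : {ffun _ -> _}) !ffunE addr0.
move=> e f; rewrite !inE => /forallP He /forallP Hf.
apply/forallP=> x; apply/forallP=> y; rewrite [(e * f)%g]/(e + f) !ffunE.
by rewrite (eqP (forallP (He _) _)) (eqP (forallP (Hf _) _)) addrACA.
Qed.
Canonical HomAB := Group Hom_group_set.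

Definition HomSp_set : {set fsdprod (A * B)%type C} :=
  [set x | (fsd1 x \in HomAB) && (fsd2 x \in Sp)].

Fact HomSp_group_set : group_set HomSp_set.
Proof.
apply/group_setP; split; first by rewrite inE !group1.
move=> [e s] [f t]; rewrite [_ \in HomSp_set]inE => /andP[/= He Hs].
rewrite [_ \in HomSp_set]inE => /andP[/= Hf Ht].
rewrite [_ \in HomSp_set]inE; apply/andP; split; last exact: groupM.
have: (s^-1)%g \in Sp by rewrite groupV.
rewrite inE => /andP[/asboolP L _].
have LD x y : (s^-1)%g (x + y) = (s^-1)%g x + (s^-1)%g y.
  by rewrite -[x in LHS]scale1r L scale1r.
move: He Hf; rewrite !inE => /forallP He /forallP Hf.
apply/forallP=> x; apply/forallP=> y; rewrite !ffunE LD.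
by rewrite (eqP (forallP (He _) _)) (eqP (forallP (Hf _) _)) addrACA.
Qed.
Canonical HomSp := Group HomSp_group_set.

Definition Theta1 (phi : cperm (heis lam)) : {ffun A * B -> C} := eta phi.

Definition ThetaD (phi : cperm (heis lam)) : fsdprod (A * B)%type C :=
  Fsd (eta phi) (bar phi)^-1%g.

End Heisenberg.

(* Main.v *)
(* Every automorphism in Aut0 is determined by its action on the section D of
   H -> A (+) B, that is, by the pair (eta, bar).  Since
   D x * D y = D (x + y) * m (delta x y / 2) and bar preserves delta (apply the
   automorphism to commutators), eta is additive; conversely any additive eta
   and any bar in Sp define an automorphism by
   D x * m c |-> D (bar x) * m (eta x + c).
   Conjugation by h has bar = 1 and eta = delta (pr h), so everything else
   reduces to the surjectivity of x |-> delta x from A (+) B onto Hom(A (+) B, C).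
   This map is injective by nondegeneracy, and |Hom(G, C)| <= |G| for C cyclic. *)
From HB Require Import structures.
Require Import Defs.
From mathcomp Require Import all_boot all_algebra all_fingroup all_solvable.
From mathcomp Require Import all_field boolp.

Set Implicit Arguments.
Unset Strict Implicit.
Unset Printing Implicit Defensive.

Import GRing.Theory Num.Theory.
Local Open Scope group_scope.

(** * Characters of finite abelian groups and the size of Hom *)

(** A generator goes to a primitive root of unity of the same order; [zE] makes the choice of
    discrete logarithm harmless. *)
Lemma cyclic_embed_algC (C : finZmodType) : cyclic [set: C] ->
  exists chi : C -> algC, [/\ injective chi, chi 0%R = 1%R &
    forall c d, chi (c + d)%R = (chi c * chi d)%R].
Proof.
move=> /cyclicP[g Cg].
have [z prz] := C_prim_root_exists (order_gt0 g).
have log c : {i | c = g ^+ i}.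
  by apply: cid; apply/cycleP; rewrite -Cg inE.
pose l c := sval (log c); have lE c : c = g ^+ l c by apply: (svalP (log c)).
have zE i j : (z ^+ i == z ^+ j)%R = (g ^+ i == g ^+ j).
  by rewrite (eq_prim_root_expr prz) eq_expg_mod_order.
exists (fun c => z ^+ l c)%R; split.
- by move=> c d /eqP; rewrite zE -!lE => /eqP.
- by apply/eqP; rewrite -(expr0 z) zE -lE expg0.
- by move=> c d; apply/eqP; rewrite -exprD zE expgD -!lE.
Qed.

(* The homomorphisms become pairwise orthogonal characters once C is embedded
   into the group of roots of unity. *)
Lemma card_additive_le (G C : finZmodType) : cyclic [set: C] ->
  #|[set f : {ffun G -> C} |
      [forall x : G, forall y : G, f (x + y)%R == (f x + f y)%R]]| <= #|G|.
Proof.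
move=> /cyclic_embed_algC[chi [chi_inj chi0 chiD]]; set H := [set f | _].
have HD f x y : f \in H -> f (x + y)%R = (f x + f y)%R.
  by rewrite inE => /forallP/(_ x)/forallP/(_ y)/eqP.
have orth f f' : f \in H -> f' \in H ->
    (\sum_(x : G) chi (f x) * chi (- f' x) = (f == f')%:R * #|G|%:R)%R.
  move=> Hf Hf'; case: eqVneq => [<-|/eqP ne].
    rewrite mul1r (eq_bigr (fun=> 1%R)) ?sumr_const // => x _.
    by rewrite -chiD subrr chi0.
  have [y ney] : exists y, f y != f' y.
    apply/existsP; apply: contra_notT ne => /existsPn e.
    by apply/ffunP=> x; apply/eqP/negPn/e.
  rewrite mul0r; set S := (\sum_x _)%R.
  (* Translating the summation variable by [y] multiplies [S] by a value of [chi] other than 1, so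
     [S] vanishes. *)
  have : (S = chi (f y - f' y)%R * S)%R.
    rewrite mulr_sumr {1}/S (reindex_inj (addrI y)); apply: eq_bigr => x _.
    by rewrite !HD // -!chiD opprD addrACA.
  move/eqP; rewrite -subr_eq0 -{1}[S]mul1r -mulrBl mulf_eq0 subr_eq0.
  rewrite -chi0 (inj_eq chi_inj) eq_sym subr_eq0 (negPf ney).
  by move/eqP.
(* By orthogonality [M *m M'] is the identity of size [#|H|]; it factors through dimension
   [#|G|]. *)
pose M := (\matrix_(i < #|H|, j < #|G|) chi (enum_val i (enum_val j)))%R.
pose M' := (\matrix_(j < #|G|, i < #|H|)
  (chi (- enum_val i (enum_val j)) / #|G|%:R))%R.
apply: (@mulmx1_min _ _ _ M M'); apply/matrixP=> i k; rewrite !mxE.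
transitivity (\sum_(x : G)
    chi (enum_val i x) * chi (- enum_val k x)%R / #|G|%:R)%R.
  rewrite [RHS](reindex (@enum_val G G)) /=; last first.
    by apply: onW_bij; apply: enum_val_bij.
  by apply: eq_bigr => j _; rewrite !mxE mulrA.
rewrite -mulr_suml orth ?enum_valP // (inj_eq enum_val_inj) mulfK //.
by rewrite pnatr_eq0 -lt0n; apply/card_gt0P; exists 0%R.
Qed.

(** * Coordinates on the Heisenberg group along the section [D] *)

Section Heisenberg.
Variables (R : comNzRingType) (A B : finLmodType R) (C : finZmodType).
Variable lam : pairing A B C.
Implicit Types (x y z : A * B) (phi psi : cperm (heis lam)) (g h : heis lam).
Local Notation D := (Defs.D lam).
Local Notation m := (Defs.m lam).
Local Notation eta := (@eta R A B C lam).
Local Notation delta := (@delta R A B C lam).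
Local Notation half := (@Defs.half _).

Lemma halfD (c d : C) : half (c + d)%R = (half c + half d)%R.
Proof. exact: mulrnDl. Qed.

Lemma halfB (c d : C) : half (c - d)%R = (half c - half d)%R.
Proof. exact: mulrnBl. Qed.

Lemma deltaDl x y z : delta (x + y)%R z = (delta x z + delta y z)%R.
Proof. by rewrite /Defs.delta /= pairDl pairDr opprD addrACA. Qed.

Lemma deltaDr x y z : delta x (y + z)%R = (delta x y + delta x z)%R.
Proof. by rewrite /Defs.delta /= pairDl pairDr opprD addrACA. Qed.

Lemma mM c d : m c * m d = m (c + d)%R.
Proof. by rewrite mA. Qed.

Lemma m_inj : injective m.
Proof. by move=> c d []. Qed.

Lemma mC c g : m c * g = g * m c.
Proof. by have /centerP[_ ->] := m_center lam c; rewrite ?inE. Qed.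

Lemma pr_mulm g c : pr (g * m c) = pr g.
Proof. by rewrite mA. Qed.

Lemma prD x : pr (D x) = x.
Proof. by case: x. Qed.

(** With [D_mulm_inj], this gives unique coordinates [D x * m c], in which automorphisms are
    computed below. *)
Lemma D_surj g : g = D (pr g) * m (hC g - half (lam (hA g) (hB g)))%R.
Proof. by rewrite mA /= addrC subrK; case: g. Qed.

Lemma D_mulm_inj x y c d : D x * m c = D y * m d -> x = y /\ c = d.
Proof. by rewrite !mA; case: x y => a b [a' b'] [<- <- /addrI]. Qed.

Lemma mul_commute_delta g h : g * h = h * g * m (delta (pr g) (pr h)).
Proof.
rewrite mA; case: g h => a b c [a' b' c'].
congr Heis => /=; [exact: addrC | exact: addrC |].
by rewrite /Defs.delta /= addrACA subrr addr0 [(c' + c)%R]addrC.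
Qed.

Lemma conj_by_delta g h : conj_by h g = g * m (delta (pr h) (pr g)).
Proof. by rewrite conj_byE (mul_commute_delta h) -mulgA mC mulgA mulgK. Qed.

Section Odd.
Hypothesis C_odd : odd #|C|.

(** Odd order lets [lam x.1 y.2] be split into two halves. Removing the cross terms of [D (x + y)]
    then leaves an alternating cocycle. *)
Lemma D_mul x y : D x * D y = D (x + y)%R * m (half (delta x y)).
Proof.
rewrite mA; congr Heis => /=.
rewrite /Defs.delta pairDl !pairDr !halfB !halfD.
rewrite -[X in (_ + X)%R = _](Defs.halfK (lam x.1 y.2)) // mulr2n.
move: (half _) (half _) (half _) (half _) => p s r q.
rewrite [(p + r)%R]addrC [(q + s + _)%R]addrACA -[RHS]addrA.
by rewrite [(s + p + _)%R]addrACA subrr addr0.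
Qed.

Lemma Dm_mul x y c d :
  D x * m c * (D y * m d) = D (x + y)%R * m (half (delta x y) + (c + d))%R.
Proof. by rewrite -mulgA (mulgA (m c)) mC -mulgA mM !mulgA D_mul -mulgA mM. Qed.

End Odd.

(** * The pair ([eta], [bar]) attached to an automorphism *)

Lemma Aut0_morph phi : phi \in Aut0 lam -> {morph phi : g h / g * h}.
Proof. by case/Aut0P=> /AutHP. Qed.

Lemma Aut0_m phi c : phi \in Aut0 lam -> phi (m c) = m c.
Proof. by case/Aut0P=> _ Z _; apply/Z/m_center. Qed.

Lemma Aut0_barE phi g : phi \in Aut0 lam -> pr (phi g) = bar phi (pr g).
Proof. by case/Aut0P=> M Z _; apply: barP. Qed.

Lemma barD phi x y : phi \in Aut0 lam ->
  bar phi (x + y)%R = (bar phi x + bar phi y)%R.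
Proof. by case/Aut0P=> _ _ L; rewrite -{1}[x]scale1r L scale1r. Qed.

Lemma eta_unique phi (e : {ffun A * B -> C}) :
  (forall x, phi (D x) = D (bar phi x) * m (e x)) -> eta phi = e.
Proof.
move=> He; rewrite /Defs.eta; case: pickP => [f /forallP Hf | /(_ e)] /=.
  apply/ffunP=> x; have := eqP (Hf x); rewrite He.
  by case/D_mulm_inj.
by move/negP; case; apply/forallP=> x; rewrite He.
Qed.

Lemma etaE phi x : phi \in Aut0 lam ->
  phi (D x) = D (bar phi x) * m (eta phi x).
Proof.
move=> phiA.
pose e := [ffun z => hC (phi (D z)) - hC (D (bar phi z))]%R.
have He z : phi (D z) = D (bar phi z) * m (e z).
  by rewrite ffunE; apply: pr_fibre; rewrite Aut0_barE // !prD.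
by rewrite (eta_unique He).
Qed.

Lemma Aut0_DmE phi x c : phi \in Aut0 lam ->
  phi (D x * m c) = D (bar phi x) * m (eta phi x + c)%R.
Proof. by move=> phiA; rewrite Aut0_morph // Aut0_m // etaE // -mulgA mM. Qed.

Lemma Aut0_bar_eta_inj phi psi : phi \in Aut0 lam -> psi \in Aut0 lam ->
  bar phi = bar psi -> eta phi = eta psi -> phi = psi.
Proof.
move=> phiA psiA Eb Ee; apply/cpermP=> g.
by rewrite (D_surj g) !Aut0_DmE // Eb Ee.
Qed.

Lemma barM phi psi : phi \in Aut0 lam -> psi \in Aut0 lam ->
  bar (phi * psi) = bar phi * bar psi.
Proof.
by move=> phiA psiA; apply: bar_unique => g; rewrite !cpermM !Aut0_barE.
Qed.

(** [psi] acts first, so only the term of [phi] is twisted; this is the source of the order reversal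
    in [ThetaD]. *)
Lemma etaM phi psi : phi \in Aut0 lam -> psi \in Aut0 lam ->
  eta (phi * psi) = [ffun x => eta psi x + eta phi (bar psi x)]%R.
Proof.
move=> phiA psiA; apply: eta_unique => x.
by rewrite cpermM etaE // Aut0_DmE // barM // cpermM ffunE addrC.
Qed.

(** [delta] measures commutators, whose values in [m] are fixed by [phi]. *)
Lemma bar_Sp phi : phi \in Aut0 lam -> bar phi \in Sp lam.
Proof.
move=> phiA; rewrite inE; apply/andP; split.
  by apply/asboolP; case/Aut0P: phiA.
apply/forallP=> x; apply/forallP=> y; apply/eqP.
have := congr1 phi (mul_commute_delta (D x) (D y)).
rewrite !Aut0_morph // mul_commute_delta => /mulgI.
by rewrite Aut0_m // !Aut0_barE // !prD => /m_inj.
Qed.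

Lemma Sp_delta alpha x y : alpha \in Sp lam ->
  delta (alpha x) (alpha y) = delta x y.
Proof. by rewrite inE => /andP[_ /forallP/(_ x)/forallP/(_ y)/eqP]. Qed.

(** Applying [phi] to [D_mul] produces the same half of [delta] on both sides, because [bar phi]
    preserves [delta]. *)
Lemma eta_Hom phi : odd #|C| -> phi \in Aut0 lam -> eta phi \in HomAB A B C.
Proof.
move=> C_odd phiA; rewrite inE; apply/forallP=> x; apply/forallP=> y; apply/eqP.
have := congr1 phi (D_mul C_odd x y).
rewrite Aut0_morph // Aut0_DmE // !etaE // Dm_mul // -barD //.
rewrite Sp_delta ?bar_Sp //.
by case/D_mulm_inj=> _; rewrite addrC => /addIr.
Qed.

Lemma Sp_D alpha x y : alpha \in Sp lam ->
  alpha (x + y)%R = (alpha x + alpha y)%R.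
Proof.
rewrite inE => /andP[/asboolP L _].
by rewrite -{1}[x]scale1r L scale1r.
Qed.

Lemma HomD e x y : e \in HomAB A B C -> e (x + y)%R = (e x + e y)%R.
Proof. by rewrite inE => /forallP/(_ x)/forallP/(_ y)/eqP. Qed.

Lemma conj_by_Aut0 h : conj_by h \in Aut0 lam.
Proof.
have /andP[/subsetP-> //] := Inn_normal lam.
by apply/imsetP; exists h; rewrite ?inE.
Qed.

Lemma eta_conj_by h : eta (conj_by h) = [ffun x => delta (pr h) x].
Proof.
by apply: eta_unique => x; rewrite conj_by_bar cperm1 ffunE conj_by_delta prD.
Qed.

(** * Realising homomorphisms and symplectic maps by automorphisms *)

Section Nondegenerate.
Hypothesis lam_nondeg : nondegenerate_pairing lam.

(** Vectors with one zero component reduce [delta] to [lam], up to sign. *)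
Lemma delta_nondeg x : (forall y, delta x y = 0%R) -> x = 0%R.
Proof.
case: x => a b Hx; case: lam_nondeg => ndl ndr.
congr pair.
  by apply: ndl => b'; rewrite -(Hx (0, b')%R) /Defs.delta /= pair0l subr0.
apply: ndr => a'; apply: oppr_inj.
by rewrite oppr0 -(Hx (a', 0)%R) /Defs.delta /= pair0r sub0r.
Qed.

(** Surjectivity comes from counting: [F] is injective and its target is no larger than its
    source. *)
Lemma Hom_deltaP e : cyclic [set: C] -> e \in HomAB A B C ->
  exists x, e = [ffun y => delta x y].
Proof.
move=> C_cyclic eH; pose F x := [ffun y => delta x y].
have F_inj : injective F.
  move=> x y /ffunP E; apply/eqP; rewrite -subr_eq0; apply/eqP.
  apply: delta_nondeg => z; apply: (addIr (delta y z)).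
  by rewrite -deltaDl subrK add0r; have := E z; rewrite !ffunE.
have : F @: [set: A * B] == HomAB A B C :> {set _}.
  rewrite eqEcard; apply/andP; split.
    apply/subsetP=> _ /imsetP[x _ ->]; rewrite inE.
    by apply/forallP=> y; apply/forallP=> z; rewrite !ffunE deltaDr.
  rewrite card_imset // cardsT.
  (* Products have no canonical finZmodType structure. *)
  pose G : finZmodType := HB.pack (A * B)%type
    (Finite.on (A * B)%type) (GRing.Zmodule.on (A * B)%type).
  exact: (@card_additive_le G C).
by move/eqP/setP/(_ e); rewrite eH => /imsetP[x _ ->]; exists x.
Qed.

Section Lift.
Hypothesis C_odd : odd #|C|.
Variables (e : {ffun A * B -> C}) (beta : cperm (A * B)%type).
Hypotheses (eH : e \in HomAB A B C) (betaS : beta \in Sp lam).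

Let f g := D (beta (pr g)) *
  m (e (pr g) + (hC g - half (lam (hA g) (hB g))))%R.

Let fE x c : f (D x * m c) = D (beta x) * m (e x + c)%R.
Proof.
by rewrite /f !mA /pr /= [(_ + c)%R]addrC addrK; case: x.
Qed.

Let f_inj : injective f.
Proof.
move=> g h; rewrite (D_surj g) (D_surj h) !fE => /D_mulm_inj[].
by move/(can_inj (cpermK beta)) => <- /addrI ->.
Qed.

Lemma lift_Aut0 : exists2 phi, phi \in Aut0 lam & bar phi = beta /\ eta phi = e.
Proof.
have f_bar g : pr (CPerm (perm f_inj) g) = beta (pr g).
  by rewrite cpermE pr_mulm prD.
have barf : bar (CPerm (perm f_inj)) = beta by apply: bar_unique.
exists (CPerm (perm f_inj)); last first.
  split=> //; apply: eta_unique => x; rewrite barf cpermE.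
  by have := fE x 0%R; rewrite mA addr0 addr0 => <-.
apply/Aut0P; split; last first.
- by rewrite barf; move: betaS; rewrite inE => /andP[/asboolP].
(* Nondegeneracy puts [z] in the image of [m]; then [m c] is [D 0 * m c], and both [beta] and [e]
   vanish at 0. *)
- move=> z; rewrite center_heis // => /imsetP[c _ ->]; rewrite cpermE.
  have D0 : D 0%R = 1 by congr Heis; rewrite /= pair0l; apply: mul0rn.
  have b0 : beta 0%R = 0%R.
    by apply: (addrI (beta 0%R)); rewrite -Sp_D // !addr0.
  have e0 : e 0%R = 0%R by apply: (addrI (e 0%R)); rewrite -HomD // !addr0.
  by rewrite -[m c]mul1g -D0 fE b0 e0 add0r.
apply/AutHP=> g h; rewrite !cpermE (D_surj g) (D_surj h).
move: (pr g) (pr h) (_ - _)%R (_ - _)%R => x y c d.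
rewrite Dm_mul // !fE Dm_mul // Sp_D // HomD // Sp_delta //.
by rewrite addrCA [(e x + e y + _)%R]addrACA.
Qed.

End Lift.
End Nondegenerate.
End Heisenberg.

(** * Exactness, commutativity and the vertical maps *)

Theorem theorem6p3 (R : comNzRingType) (A B : finLmodType R) (C : finZmodType)
    (lam : pairing A B C)
    (A_neq0 : exists a : A, a != 0%R)
    (C_cyclic : cyclic [set: C])
    (C_odd : odd #|C|)
    (lam_balanced : R_balanced lam)
    (lam_nondeg : nondegenerate_pairing lam) :
  [/\ forall phi, phi \in Aut0 lam -> forall g, pr (phi g) = bar phi (pr g),
      forall phi, phi \in Aut0 lam ->
        forall x, phi (D lam x) = D lam (bar phi x) * m lam (eta phi x) &
      exists Theta_tilde Theta_bar :
          coset_of (Inn lam) -> cperm (A * B)%type,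
        [/\ forall phi, phi \in Aut0 lam ->
              Theta_tilde (coset (Inn lam) phi) = (bar phi)^-1,
            forall phi, phi \in Aut0 lam ->
              Theta_bar (coset (Inn lam) phi) = bar phi &
            [/\ short_exact (Inn lam) (Aut0 lam) (Out0 lam)
                  id (coset (Inn lam))
              , short_exact (HomAB A B C) (HomSp lam) (Sp lam)
                  (fun e => Fsd e 1) (@fsd2 _ _)
              , {in Inn lam, forall phi, ThetaD phi = Fsd (Theta1 phi) 1}
                /\ {in Aut0 lam, forall phi,
                      fsd2 (ThetaD phi)
                        = Theta_tilde (coset (Inn lam) phi)}
              , [/\ anti_isom (Inn lam) (HomAB A B C) (@Theta1 _ _ _ _ lam),
                    anti_isom (Aut0 lam) (HomSp lam) (@ThetaD _ _ _ _ lam) &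
                    anti_isom (Out0 lam) (Sp lam) Theta_tilde]
              & misom (Out0 lam) (Sp lam) Theta_bar]]].
Proof.
have Inn_sub phi : phi \in Inn lam -> phi \in Aut0 lam.
  by move: phi; apply/subsetP/normal_sub/Inn_normal.
have Inn_bar phi : phi \in Inn lam -> bar phi = 1.
  by case/imsetP=> h _ ->; apply: conj_by_bar.
(* The kernel of [bar] is inner: [eta phi] is some [delta x], and conjugation by [D x] has the same
   [bar] and [eta]. *)
have bar_Inn phi : phi \in Aut0 lam -> bar phi = 1 -> phi \in Inn lam.
  move=> phiA b1.
  have [x Ex] := Hom_deltaP lam_nondeg C_cyclic (eta_Hom C_odd phiA).
  suff -> : phi = conj_by (D lam x).
    by apply/imsetP; exists (D lam x); rewrite ?inE.
  apply: Aut0_bar_eta_inj => //; first exact: conj_by_Aut0.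
    by rewrite conj_by_bar.
  by rewrite Ex eta_conj_by prD.
have nIA phi : phi \in Aut0 lam -> phi \in 'N(Inn lam).
  by move: phi; apply/subsetP/normal_norm/Inn_normal.
(* The chosen representative differs from any other by an inner factor, on which [bar] is
   trivial. *)
pose Tb (c : coset_of (Inn lam)) := bar (repr c).
have TbE phi : phi \in Aut0 lam -> Tb (coset (Inn lam) phi) = bar phi.
  move=> phiA; rewrite /Tb val_coset ?nIA //; case: repr_rcosetP => psi psiI.
  by rewrite (barM (Inn_sub _ psiI) phiA) (Inn_bar _ psiI) mul1g.
have OutP c : c \in Out0 lam ->
    exists2 phi, phi \in Aut0 lam & c = coset (Inn lam) phi.
  by case/morphimP=> phi _ phiA ->; exists phi.
have cosetM phi psi : phi \in Aut0 lam -> psi \in Aut0 lam ->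
    coset (Inn lam) (phi * psi) = coset (Inn lam) phi * coset (Inn lam) psi.
  by move=> phiA psiA; rewrite morphM ?nIA.
have Tb_M : {in Out0 lam &, {morph Tb : c d / c * d}}.
  move=> _ _ /OutP[phi phiA ->] /OutP[psi psiA ->].
  by rewrite -cosetM // !TbE ?groupM // barM.
have Tb_inj : {in Out0 lam &, injective Tb}.
  move=> _ _ /OutP[phi phiA ->] /OutP[psi psiA ->].
  rewrite !TbE // => E; apply/eqP.
  rewrite eq_mulVg1 -morphV ?nIA // -morphM ?groupV ?nIA //.
  apply/eqP/coset_id/bar_Inn; first by rewrite groupM ?groupV.
  (* Multiplying by [bar phi] avoids computing [bar] of an inverse. *)
  apply: (mulgI (bar phi)); rewrite -barM ?groupM ?groupV //.
  by rewrite mulKVg mulg1.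
have Tb_im : Tb @: Out0 lam = Sp lam.
  apply/setP=> beta; apply/imsetP/idP => [[_ /OutP[phi phiA ->] ->]|betaS].
    by rewrite TbE ?bar_Sp.
  (* [group1] selects the zero homomorphism as [eta] of the lift. *)
  have [phi phiA [<- _]] := lift_Aut0 lam_nondeg C_odd (group1 _) betaS.
  by exists (coset (Inn lam) phi); rewrite ?TbE // mem_quotient.
split=> [phi phiA g|phi phiA x|]; [exact: Aut0_barE | exact: etaE |].
(* Inverting the values of the isomorphism [Tb] gives the anti-isomorphism. *)
exists (fun c => (Tb c)^-1), Tb; split=> [phi /TbE-> //|//|].
split.
- split=> //.
  + split=> [phi phiA|]; first by rewrite mem_quotient.
    by move=> phi psi; apply: cosetM.
  + rewrite imset_id; apply/setP=> phi; rewrite inE; apply/idP/andP.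
      by move=> phiI; rewrite Inn_sub // coset_id.
    by case=> phiA /eqP; apply: coset_idr; apply: nIA.
  + by rewrite -(morphimEsub _ (normal_norm (Inn_normal lam))).
- split.
  + split=> [e eH|e f eH fH]; first by rewrite inE eH group1.
    congr Fsd; last by rewrite mulg1.
    by apply/ffunP=> x; rewrite !ffunE invg1 cperm1.
  + by split=> [x|x y _ _ //]; rewrite inE => /andP[].
  + by move=> e f _ _ [].
  + apply/setP=> -[e s]; rewrite inE; apply/imsetP/andP.
      by case=> f fH [-> ->]; rewrite inE fH group1 eqxx.
    by rewrite inE => -[/andP[/= eH _] /eqP->]; exists e.
  + apply/setP=> s; apply/imsetP/idP => [[[e t]]|sS].
      by rewrite inE => /andP[/= _ tS] ->.
    by exists (Fsd 1 s) => //; rewrite inE group1.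
- split=> phi phiI; first by rewrite /ThetaD Inn_bar // invg1.
  by rewrite TbE.
- split.
  + split.
    * move=> phi psi phiI psiI; rewrite /Theta1 etaM ?Inn_sub //.
      by apply/ffunP=> x; rewrite !ffunE Inn_bar // cperm1.
    * move=> phi psi phiI psiI; apply: Aut0_bar_eta_inj; rewrite ?Inn_sub //.
      by rewrite !Inn_bar.
    * apply/setP=> e; apply/imsetP/idP => [[phi phiI ->]|eH].
        by apply: eta_Hom => //; apply: Inn_sub.
      have [x ->] := Hom_deltaP lam_nondeg C_cyclic eH.
      exists (conj_by (D lam x)); last by rewrite /Theta1 eta_conj_by prD.
      by apply/imsetP; exists (D lam x); rewrite ?inE.
  + split.
    * move=> phi psi phiA psiA; rewrite /ThetaD barM // invMg etaM //.
      (* The second component of [ThetaD psi] is inverse to [bar psi], so its action on [eta phi] is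
         precomposition with [bar psi]. *)
      by congr Fsd; apply/ffunP=> x; rewrite !ffunE invgK.
    * move=> phi psi phiA psiA E; apply: Aut0_bar_eta_inj => //.
        by apply: invg_inj; apply: (congr1 (@fsd2 _ _) E).
      exact: (congr1 (@fsd1 _ _) E).
    * apply/setP=> -[e s]; apply/imsetP/idP => [[phi phiA ->]|].
        by rewrite inE /= eta_Hom // groupV bar_Sp.
      (* The automorphism sought must have [bar] equal to the inverse of [s]. *)
      rewrite inE => /andP[/= eH]; rewrite -groupV => sS.
      have [phi phiA [Eb Ee]] := lift_Aut0 lam_nondeg C_odd eH sS.
      by exists phi; rewrite // /ThetaD Ee Eb invgK.
  + split=> [c d cO dO|c d cO dO /invg_inj|]; first by rewrite Tb_M // invMg.
      exact: Tb_inj.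
    apply/setP=> beta; apply/imsetP/idP => [[c cO ->]|].
      by rewrite groupV -Tb_im imset_f.
    rewrite -groupV -Tb_im => /imsetP[c cO E].
    by exists c; rewrite // -E invgK.
- apply/misomP; have TbM : morphic (Out0 lam) Tb.
    by apply/morphicP=> c d; apply: Tb_M.
  exists TbM; apply/isomP; split; first by apply/injmP.
  by rewrite morphimEdom.
Qed.
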